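(* Let $L$ be a finite-dimensional Lie algebra over an algebraically closed field of characteristic $0$, let $J$ be a Lie-orthogonal operator on $L$ having the eigenvalue $\lambda=1$, and let $I_1=L_1+Z$ be the ideal corresponding to this eigenvalue. Then the restriction $J_1$ of the operator $J$ to the ideal $I_1$ can be represented, up to equivalence of Lie-orthogonal operators on $I_1$, in the form $J_1=\mathrm{Id}_{I_1}+N$, where $N$ is a nilpotent operator on $I_1$ and the image of $N$ is contained in the radical $R_1$ of the ideal $I_1$.
   Context: A linear operator $J$ on a Lie algebra $L$ is called Lie-orthogonal if $[Jx,Jy]=[x,y]$ for all $x,y\in L$. Two Lie-orthogonal operators $J$ and $\tilde J$ on a Lie algebra are called equivalent if the image of $J-\tilde J$ is contained in the center of this algebra; the claim thus says that $J_1$ is equivalent, as a Lie-orthogonal operator on $I_1$, to a Lie-orthogonal operator on $I_1$ of the form $\mathrm{Id}_{I_1}+N$. Here $L_1$ is the generalized eigenspace of $J$ corresponding to the eigenvalue $1$ and $Z$ is the center of $L$; the subspace $I_1=L_1+Z$ is a $J$-invariant ideal of $L$. The radical of a Lie algebra is its maximal solvable ideal. *)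

(* Defs.v *)
From HB Require Import structures.
From mathcomp Require Import all_boot all_order all_algebra.

Set Implicit Arguments.
Unset Strict Implicit.
Unset Printing Implicit Defensive.

Import GRing.Theory.
Local Open Scope ring_scope.

HB.mixin Record Vector_isLieAlgebra (F : fieldType) (L : Type)
    of Vector F L := {
  lie : L -> L -> L;
  lie_linear_l : forall y, linear (lie^~ y);
  lie_linear_r : forall x, linear (lie x);
  liexx : forall x, lie x x = 0;
  lie_jacobi : forall x y z,
    lie x (lie y z) + lie y (lie z x) + lie z (lie x y) = 0
}.

#[short(type="lieAlgType")]
HB.structure Definition LieAlgebra (F : fieldType) :=
  { L of Vector_isLieAlgebra F L & Vector F L }.

Notation "[lie x , y ]" := (lie x y)
  (at level 0, x at level 99, y at level 99, format "[lie  x ,  y ]")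
  : ring_scope.

Section LieBasics.

Variables (F : fieldType) (L : lieAlgType F).
Implicit Types (x y z : L) (U V W I : {vspace L}).

HB.instance Definition _ x :=
  @GRing.isLinear.Build F L L *:%R (lie x) (lie_linear_r x).

Lemma lieDl x y z : [lie x + y, z] = [lie x, z] + [lie y, z].
Proof. by have := lie_linear_l z 1 x y; rewrite !scale1r. Qed.

Lemma lieDr x y z : [lie x, y + z] = [lie x, y] + [lie x, z].
Proof. by have := lie_linear_r x 1 y z; rewrite !scale1r. Qed.

Lemma lie0x z : [lie 0, z] = 0.
Proof. by apply: (addrI [lie 0, z]); rewrite -lieDl !addr0. Qed.

Lemma lieZl a x z : [lie a *: x, z] = a *: [lie x, z].
Proof. by have := lie_linear_l z a x 0; rewrite !addr0 lie0x addr0. Qed.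

Lemma lie_anti x y : [lie x, y] = - [lie y, x].
Proof.
apply/eqP; rewrite -addr_eq0; apply/eqP.
by have := liexx (x + y); rewrite lieDl !lieDr !liexx addr0 add0r.
Qed.

Definition lie_ad x : 'End(L) := linfun (lie x).

Fact lie_ad_is_linear : linear lie_ad.
Proof.
move=> a x y; apply/lfunP=> z.
by rewrite add_lfunE scale_lfunE !lfunE /= lieDl lieZl.
Qed.
HB.instance Definition _ :=
  @GRing.isLinear.Build F L 'Hom(L, L) *:%R lie_ad lie_ad_is_linear.

Definition lie_center : {vspace L} := lker (linfun lie_ad).

Lemma lie_centerP x : reflect (forall y, [lie x, y] = 0) (x \in lie_center).
Proof.
rewrite memv_ker lfunE; apply: (iffP eqP) => [x0 y | x0].
  by have /lfunP/(_ y) := x0; rewrite lfunE zero_lfunE.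
by apply/lfunP=> y; rewrite lfunE zero_lfunE; apply: x0.
Qed.

Definition is_lie_ideal I := forall x y, x \in I -> [lie x, y] \in I.

Definition lie_prod U V : {vspace L} :=
  <<[seq [lie x, y] | x <- vbasis U, y <- vbasis V]>>%VS.

Lemma mem_lie_prod U V x y :
  x \in U -> y \in V -> [lie x, y] \in lie_prod U V.
Proof.
move=> xU yV; rewrite (coord_vbasis xU) (coord_vbasis yV).
rewrite linear_sum memv_suml // => j _; rewrite linearZ memvZ //=.
rewrite lie_anti memvN linear_sum memv_suml // => i _.
rewrite linearZ memvZ //=.
by rewrite lie_anti memvN memv_span // allpairs_f ?mem_nth ?size_tuple.
Qed.

Lemma lie_prod_sub U V W :
  (forall x y, x \in U -> y \in V -> [lie x, y] \in W) ->
  (lie_prod U V <= W)%VS.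
Proof.
move=> UVW; apply/span_subvP=> _ /allpairsP[[x y] /= [xU yV ->]].
by rewrite UVW ?vbasis_mem.
Qed.

Definition lie_derived k U : {vspace L} := iter k (fun V => lie_prod V V) U.

Definition lie_solvable U := exists k, lie_derived k U = 0%VS.

(* Sums of solvable ideals are solvable, so the maximal solvable ideal is the
   greatest one. *)
Definition is_lie_radical (R : {vspace L}) :=
  [/\ is_lie_ideal R, lie_solvable R
    & forall I, is_lie_ideal I -> lie_solvable I -> (I <= R)%VS].

Definition lie_orthogonal (J : 'End(L)) :=
  forall x y, [lie J x, J y] = [lie x, y].

Definition lie_equiv (J J' : 'End(L)) := (limg (J - J') <= lie_center)%VS.

End LieBasics.

Arguments lie_center {F} L.

Record lie_ideal (F : fieldType) (L : lieAlgType F) := LieIdeal {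
  lie_ideal_val :> {vspace L};
  lie_idealP : is_lie_ideal lie_ideal_val
}.

Section IdealLieAlgebra.

Variables (F : fieldType) (L : lieAlgType F) (I : lie_ideal L).

Definition sub_lie (u v : subvs_of I) : subvs_of I :=
  vsproj I [lie vsval u, vsval v].

Lemma vsval_sub_lie u v : vsval (sub_lie u v) = [lie vsval u, vsval v].
Proof. by rewrite vsprojK //; apply: lie_idealP; apply: subvsP. Qed.

Fact sub_lie_linear_l v : linear (sub_lie^~ v).
Proof.
move=> a u w; apply: val_inj; rewrite /= !vsval_sub_lie linearP /=.
by rewrite lieDl lieZl.
Qed.

Fact sub_lie_linear_r u : linear (sub_lie u).
Proof.
by move=> a v w; apply: val_inj; rewrite /= !vsval_sub_lie !linearP.
Qed.

Fact sub_liexx u : sub_lie u u = 0.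
Proof. by apply: val_inj; rewrite /= vsval_sub_lie liexx. Qed.

Fact sub_lie_jacobi u v w :
  sub_lie u (sub_lie v w) + sub_lie v (sub_lie w u) + sub_lie w (sub_lie u v)
  = 0.
Proof.
apply: val_inj; rewrite /= !vsval_sub_lie.
exact: lie_jacobi.
Qed.

HB.instance Definition _ := Vector_isLieAlgebra.Build F (subvs_of I)
  sub_lie_linear_l sub_lie_linear_r sub_liexx sub_lie_jacobi.

Lemma vsval_lie (u v : subvs_of I) : vsval [lie u, v] = [lie vsval u, vsval v].
Proof. exact: vsval_sub_lie. Qed.

End IdealLieAlgebra.

Section Operators.

Variables (F : fieldType) (V : vectType F).
Implicit Types (f : 'End(V)) (U : {vspace V}) (x : V).

Definition lfun_nilpotent f := exists k, forall x, iter k f x = 0.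

Definition lfun_pow f k : 'End(V) := iter k (comp_lfun f) \1%VF.

Lemma lfun_powE f k x : lfun_pow f k x = iter k f x.
Proof. by elim: k => [|k IH]; rewrite ?id_lfunE // comp_lfunE IH. Qed.

(* The kernels of the powers of an operator are stationary from the dimension
   of the space on; see gen_eigenspaceP. *)
Definition gen_eigenspace f (a : F) : {vspace V} :=
  lker (lfun_pow (f - a *: \1%VF) (\dim {:V})).

Lemma iter_lfun0 f k : iter k f 0 = 0.
Proof. by elim: k => //= k ->; rewrite linear0. Qed.

Lemma iter_lfun_stable f k x : iter k f x = 0 -> iter (\dim {:V}) f x = 0.
Proof.
pose K m := lker (lfun_pow f m).
have memK m y : (y \in K m) = (iter m f y == 0) by rewrite memv_ker lfun_powE.
have KS m : (K m <= K m.+1)%VS.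
  by apply/subvP=> y; rewrite !memK /= => /eqP->; rewrite linear0.
pose stab m := forall y, iter m.+1 f y = 0 -> iter m f y = 0.
have stabS m : stab m -> stab m.+1.
  by move=> sm y; rewrite iterSr => /sm; rewrite -iterSr.
have dimK m : stab m \/ (m <= \dim (K m))%N.
  elim: m => [|m [/stabS|IH]]; [by right | by left | ].
  have:= dimvS (KS m); rewrite leq_eqVlt => /orP[eqK|ltK]; last first.
    by right; apply: leq_ltn_trans ltK.
  left; apply: stabS => y y0; apply/eqP; rewrite -memK.
  have /eqP-> : K m == K m.+1 by rewrite eqEdim KS (eqP eqK) leqnn.
  by rewrite memK y0.
have stab_n : stab (\dim {:V}).
  case: (dimK (\dim {:V})) => // leK y _; apply/eqP; rewrite -memK.
  have /eqP-> : K (\dim {:V}) == fullv by rewrite eqEdim subvf.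
  exact: memvf.
have stabD j y : iter (j + \dim {:V}) f y = 0 -> iter (\dim {:V}) f y = 0.
  elim: j y => // j IH y; rewrite addSn iterSr => /IH.
  by rewrite -iterSr => /stab_n.
move=> x0; apply: (stabD k); rewrite addnC iterD x0.
exact: iter_lfun0.
Qed.

Lemma gen_eigenspaceP f a x :
  reflect (exists k, iter k (f - a *: \1%VF) x = 0) (x \in gen_eigenspace f a).
Proof.
rewrite memv_ker lfun_powE; apply: (iffP eqP) => [x0|[k]].
  by exists (\dim {:V}).
exact: iter_lfun_stable.
Qed.

Lemma iter_lfun_limg f j x :
  exists y, iter (\dim {:V}) f x = iter (\dim {:V} + j) f y.
Proof.
set n := \dim {:V}.
have sub : (limg (lfun_pow f (n + j)) <= limg (lfun_pow f n))%VS.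
  apply/subvP=> _ /memv_imgP[y _ ->]; rewrite lfun_powE iterD -lfun_powE.
  by rewrite memv_img ?memvf.
have eqk : lker (lfun_pow f (n + j)) = lker (lfun_pow f n).
  apply/vspaceP=> y; rewrite !memv_ker !lfun_powE; apply/eqP/eqP=> [|y0].
    exact: iter_lfun_stable.
  by rewrite addnC iterD y0 iter_lfun0.
have dimE (h : 'End(V)) : \dim (limg h) = (\dim {:V} - \dim (lker h))%N.
  by have <- := limg_ker_dim h fullv; rewrite capfv addKn.
have /eqP eqI : limg (lfun_pow f (n + j)) == limg (lfun_pow f n).
  by rewrite eqEdim sub !dimE eqk /=.
have : lfun_pow f n x \in limg (lfun_pow f n) by rewrite memv_img ?memvf.
rewrite -eqI => /memv_imgP[y _ e]; exists y.
by rewrite -!lfun_powE.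
Qed.

Lemma fitting f x : exists x0 y,
  iter (\dim {:V}) f x0 = 0 /\ x = x0 + iter (\dim {:V}) f y.
Proof.
have [y e] := iter_lfun_limg f (\dim {:V}) x.
exists (x - iter (\dim {:V}) f y), y; split; last by rewrite subrK.
by rewrite -!lfun_powE linearB /= !lfun_powE e iterD subrr.
Qed.

(* Meaningful when U is f-invariant; see vsval_lfun_restrict. *)
Definition lfun_restrict U f : 'End(subvs_of U) :=
  (linfun (vsproj U) \o (f \o linfun (@vsval _ _ U)))%VF.

Lemma vsval_lfun_restrict U f (u : subvs_of U) :
  (f @: U <= U)%VS -> vsval (lfun_restrict U f u) = f (vsval u).
Proof.
move=> fU; rewrite !comp_lfunE !lfunE /= vsprojK //.
by rewrite (subvP fU) // memv_img // subvsP.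
Qed.

End Operators.

Section EigenvalueOne.

Variables (F : fieldType) (L : lieAlgType F) (J : 'End(L)).
Hypothesis oJ : lie_orthogonal J.

Let n := \dim {:L}.
Let g : 'End(L) := J - 1 *: \1%VF.

Let JE x : J x = x + g x.
Proof.
rewrite /g add_lfunE opp_lfunE scale_lfunE id_lfunE scale1r.
by rewrite addrC subrK.
Qed.

Let lie_L1_img k x y : iter k g x = 0 -> [lie x, iter n g y] = 0.
Proof.
elim: k x y => [|k IH] x y; first by move=> /= ->; rewrite lie0x.
rewrite iterSr => /IH {}IH.
have [z ->] := iter_lfun_limg g 1 y; rewrite -/n addn1 iterS.
have := oJ x (iter n g z); rewrite !JE lieDl -iterS iterSr !lieDr !IH !addr0.
by move=> e; apply: (addrI [lie x, iter n g z]); rewrite addr0.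
Qed.

Fact is_lie_ideal_I1 : is_lie_ideal (gen_eigenspace J 1 + lie_center L)%VS.
Proof.
move=> _ v /memv_addP[x xL1 [z zZ ->]].
have zv y : [lie z, y] = 0 by apply: (lie_centerP _ zZ).
move: xL1; rewrite memv_ker lfun_powE => /eqP x0.
rewrite lieDl zv addr0; have [y [m [y0 ->]]] := fitting g v.
rewrite lieDr (lie_L1_img _ x0) addr0.
have [w [m' [w0 e]]] := fitting g [lie x, y].
rewrite e memv_add //; first by rewrite memv_ker lfun_powE w0.
apply/lie_centerP=> u; have [u1 [m'' [u0 ->]]] := fitting g u.
rewrite lieDr -/n lie_anti (lie_L1_img _ u0) oppr0 add0r.
have -> : iter n g m' = [lie x, y] - w by rewrite e addrC addKr.
rewrite lieDl -scaleN1r lieZl (lie_L1_img _ w0) scaler0 addr0 lie_anti.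
have := lie_jacobi x y (iter n g m'').
rewrite (lie_L1_img _ y0) [X in lie y X]lie_anti (lie_L1_img _ x0).
by rewrite oppr0 !linear0 !add0r => ->; rewrite oppr0.
Qed.

Definition ideal_I1 : lie_ideal L := LieIdeal is_lie_ideal_I1.

Lemma J_invariant_I1 : (J @: ideal_I1 <= ideal_I1)%VS.
Proof.
rewrite /= limgD; apply/subvP=> _ /memv_addP[p Jp [q Jq ->]].
case/memv_imgP: Jp => x xL1 ->; case/memv_imgP: Jq => z zZ ->.
apply: memv_add.
  move: xL1; rewrite !memv_ker !lfun_powE -/g JE -!lfun_powE linearD /=.
  rewrite !lfun_powE -iterSr iterS => /eqP->.
  by rewrite linear0 addr0.
apply/lie_centerP=> u; have [u0 [m [u00 ->]]] := fitting J u.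
have [y ->] := iter_lfun_limg J 1 m; rewrite addn1 iterS lieDr oJ.
have orth k a b : [lie a, b] = [lie iter k J a, iter k J b].
  by elim: k => //= k ->; rewrite oJ.
rewrite (orth n) u00 linear0 add0r.
exact: (lie_centerP _ zZ).
Qed.

Lemma lie_orthogonal_I1 : lie_orthogonal (lfun_restrict ideal_I1 J).
Proof.
move=> u v; apply: val_inj; apply: etrans (vsval_lie _ _) _.
by rewrite !vsval_lfun_restrict ?J_invariant_I1 // oJ -vsval_lie.
Qed.

End EigenvalueOne.

(* Main.v *)
Require Import Defs.
From HB Require Import structures.
From mathcomp Require Import all_boot all_order all_algebra.
From mathcomp Require Import ring.
From Stdlib Require Import Classical.

(* Let M be the ideal I_1, R its radical, and M = L_1 + Z' with Z' central; N is
   J - 1 on L_1 and 0 on a complement of L_1 inside Z', so J' = 1 + N is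
   Lie-orthogonal and unipotent. The operator S = J' - J'^-1 is skew-adjoint,
   i.e. [S x, y] = - [x, S y], and N^2 + 2 N = S J'; since N is nilpotent, the
   image of N is in R as soon as the image of S is.

   The latter holds because a Lie algebra g without nonzero abelian ideals (here
   M / R) has no nonzero skew-adjoint operator. Neither the Levi decomposition
   nor Cartan's criterion is needed: (x, y) |-> [S x, y] is a biderivation, and
   the resulting identities show that self-adjoint operators are in the centroid,
   and then that S^2, which is in the centroid, kills [[g, g], [g, g]] and hence
   vanishes. So skew-adjoint operators square to zero, anticommute, and are
   stable under products and under commutators with ad h. If one of them, T, is
   nonzero of minimal rank, then all its products with the others vanish, and its
   image lies in an abelian ideal: the center of the common kernel of all
   skew-adjoint operators. *)

Set Implicit Arguments.
Unset Strict Implicit.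
Unset Printing Implicit Defensive.

Import GRing.Theory.
Local Open Scope ring_scope.

(** * Linear algebra: functionals and greatest subspaces *)

Lemma eq_of_subr (V : zmodType) (a b c d : V) : a = b -> c - d = a - b -> c = d.
Proof. by move=> -> /eqP; rewrite subrr subr_eq0 => /eqP. Qed.

Section Subspaces.

Variables (F : fieldType) (V : vectType F).

(** Moves an identity between vectors into the field, where [ring] applies through [eq_of_subr]. *)
Lemma scalar_ext (x y : V) :
  (forall f : {scalar V}, f x = f y :> F) -> x = y.
Proof.
move=> fxy; rewrite (coord_vbasis (memvf x)) (coord_vbasis (memvf y)).
by apply: eq_bigr => i _; rewrite (fxy (coord (vbasis fullv) i)).
Qed.

Lemma addvv_eq0 (x : V) : 2 != 0 :> F -> x + x = 0 -> x = 0.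
Proof.
move=> two_nz; rewrite -mulr2n -scaler_nat => /eqP.
by rewrite scaler_eq0 (negPf two_nz) => /eqP.
Qed.

(** Induction on the codimension: as long as some [W] with [Q W] is not inside [U], passing to
    [U + W] raises the dimension. *)
Lemma ex_greatest_vspace (Q : {vspace V} -> Prop) :
  Q 0%VS -> (forall U W, Q U -> Q W -> Q (U + W)%VS) ->
  exists2 U, Q U & forall W, Q W -> (W <= U)%VS.
Proof.
move=> Q0 QD.
suff H n U : (\dim {:V} - \dim U <= n)%N -> Q U ->
    exists2 U, Q U & forall W, Q W -> (W <= U)%VS by apply: H (leqnn _) Q0.
elim: n U => [|n IH] U leU QU;
  case: (classic (exists2 W, Q W & ~~ (W <= U)%VS)) => [[W QW WU]|noW].
- case/negP: WU; apply: subv_trans (subvf W) _.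
  by rewrite -(geq_leqif (dimv_leqif_sup (subvf U))) -subn_eq0 -leqn0.
- by exists U => // W QW; apply/negPn/negP => WU; case: noW; exists W.
- apply: (IH (U + W)%VS); last exact: QD.
  have ltU: (\dim U < \dim (U + W))%N.
    rewrite (ltn_leqif (dimv_leqif_sup (addvSl U W))) subv_add subvv.
    exact: WU.
  rewrite -ltnS; apply: leq_trans leU; rewrite ltn_sub2l //.
  exact: leq_trans ltU (dimvS (subvf _)).
- by exists U => // W QW; apply/negPn/negP => WU; case: noW; exists W.
Qed.

(** The greatest subspace contained in [P] contains the line through every vector of [P]. *)
Lemma ex_vspace_pred (P : V -> Prop) :
  P 0 -> (forall a x y, P x -> P y -> P (a *: x + y)) ->
  exists U : {vspace V}, forall x, x \in U <-> P x.
Proof.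
move=> P0 Plin.
have [||U PU maxU] :=
    @ex_greatest_vspace (fun U => forall x, x \in U -> P x).
- by move=> x; rewrite memv0 => /eqP->.
- move=> U W PU PW _ /memv_addP[x xU [y yW ->]].
  by rewrite -[x]scale1r; apply: Plin; auto.
exists U => x; split=> [|Px]; first exact: PU.
have /subvP : (<[x]> <= U)%VS; last by apply; exact: memv_line.
by apply: maxU => _ /vlineP[a ->]; rewrite -[_ *: _]addr0; apply: Plin.
Qed.

End Subspaces.

(** The sign [e] is 1 for self-adjoint and -1 for skew-adjoint operators; [biderivation_id] serves
    both cases. *)
Definition lie_adjoint_sign (F : fieldType) (g : lieAlgType F) (e : F)
    (S : 'End(g)) :=
  forall x y, [lie S x, y] = e *: [lie x, S y].

Section LieIdentities.

Variables (F : fieldType) (g : lieAlgType F).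
Implicit Types (x y z u v : g) (S T : 'End(g)).

Lemma lieNl x y : [lie - x, y] = - [lie x, y].
Proof. by rewrite -scaleN1r lieZl scaleN1r. Qed.

Lemma lieBl x y z : [lie x - y, z] = [lie x, z] - [lie y, z].
Proof. by rewrite lieDl lieNl. Qed.

Lemma lieNr x y : [lie x, - y] = - [lie x, y].
Proof. exact: linearN. Qed.

Lemma lieBr x y z : [lie x, y - z] = [lie x, y] - [lie x, z].
Proof. exact: linearB. Qed.

Lemma lieZr a x y : [lie x, a *: y] = a *: [lie x, y].
Proof. exact: linearZ. Qed.

Lemma liex0 x : [lie x, 0] = 0.
Proof. exact: linear0. Qed.

Lemma lie_derivr x y z :
  [lie x, [lie y, z]] = [lie [lie x, y], z] + [lie y, [lie x, z]].
Proof.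
rewrite (lie_anti [lie x, y]) (lie_anti x z) linearN /= -opprD.
by apply/eqP; rewrite -addr_eq0 addrA addrAC lie_jacobi.
Qed.

Lemma lie_derivl x y z :
  [lie [lie x, y], z] = [lie x, [lie y, z]] - [lie y, [lie x, z]].
Proof. by rewrite (lie_derivr x y z) addrK. Qed.

(* (x, y) |-> [S x, y] is a biderivation; both sides come from expanding its
   value at ([x, u], [y, v]) in the two possible orders. *)
Lemma biderivation_id e S x y u v : lie_adjoint_sign e S ->
  [lie [lie S x, y], [lie u, v]] + [lie [lie S x, v], [lie y, u]] =
  [lie [lie x, y], [lie S u, v]] + [lie [lie S u, y], [lie x, v]].
Proof.
move=> eS.
have derS a b c : [lie S [lie a, b], c] = [lie [lie S a, c], b]
    + [lie a, [lie S b, c]].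
  rewrite eS lie_derivl scalerBr -!(lieZr _ _ [lie _, _]) -!eS.
  by rewrite (lie_anti [lie S a, c]) addrC.
have := erefl [lie S [lie x, u], [lie y, v]].
rewrite {1}derS (lie_derivr (S x)) (lie_derivr (S u)).
rewrite (lie_derivr (S [lie x, u])) !derS.
move: [lie S x, y] [lie S x, v] [lie S u, y] [lie S u, v] => a b c d.
have flip (p q r : g) :
    [lie p, [lie q, r]] = [lie q, [lie p, r]] - [lie r, [lie p, q]].
  by rewrite lie_derivr (lie_anti [lie p, q]) addrC.
rewrite (flip a) (flip b) (flip c) (lie_derivl x y d) !lieDl !lieDr.
rewrite !(lie_anti [lie _, _]) (lie_anti x c) (lie_anti y b) !lieNr.
move=> eqE; apply: scalar_ext => f; move/(congr1 f): eqE.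
rewrite !(raddfD, raddfB, raddfN) /= => eqE.
by apply: (eq_of_subr (esym eqE)); ring.
Qed.

End LieIdentities.

(* Ideals as Prop-valued predicates: those used below are intersections of
   infinite families, which have no direct description as {vspace g}. *)
Definition lie_ideal_pred (F : fieldType) (g : lieAlgType F) (P : g -> Prop) :=
  [/\ P 0, forall a x y, P x -> P y -> P (a *: x + y)
    & forall x y, P x -> P [lie x, y]].

Definition no_abelian_ideal (F : fieldType) (g : lieAlgType F) :=
  forall P : g -> Prop, lie_ideal_pred P ->
  (forall x y, P x -> P y -> [lie x, y] = 0) -> forall x, P x -> x = 0.

(** * Self-adjoint and skew-adjoint operators in the absence of abelian ideals *)

Section NoAbelianIdeal.

Variables (F : fieldType) (g : lieAlgType F).
Hypotheses (two_nz : 2 != 0 :> F) (noab : no_abelian_ideal g).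
Implicit Types (x y z u v : g) (S T : 'End(g)).

(** By the Jacobi identity, the center of an ideal is again an ideal of [g], and it is abelian. *)
Lemma ideal_center_eq0 (P : g -> Prop) x : lie_ideal_pred P ->
  P x -> (forall y, P y -> [lie x, y] = 0) -> x = 0.
Proof.
move=> idP Px xP; have [P0 Plin Pid] := idP.
apply: (noab (P := fun z => P z /\ forall y, P y -> [lie z, y] = 0)) => //.
- split=> [|a y z [Py yP] [Pz zP]|y z [Py yP]].
  + by split=> // y _; rewrite lie0x.
  + split=> [|t Pt]; first exact: Plin.
    by rewrite lieDl lieZl yP // zP // scaler0 addr0.
  + split=> [|t Pt]; first exact: Pid.
    rewrite lie_derivl (yP _ Pt) liex0 subr0 yP // lie_anti -scaleN1r.
    by rewrite -[_ *: _]addr0; apply: Plin => //; apply: Pid.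
- by move=> y z [_ yP] [Pz _]; apply: yP.
Qed.

Lemma lie_center_eq0 x : (forall y, [lie x, y] = 0) -> x = 0.
Proof. by move=> x0; apply: (@ideal_center_eq0 (fun=> True)). Qed.

(** The centralizer [C] of the derived algebra is an ideal; each [[lie x, y]] lies in it and
    commutes with it, hence vanishes, so [x] is central. *)
Lemma centralizer_derived_eq0 x :
  (forall u v, [lie x, [lie u, v]] = 0) -> x = 0.
Proof.
pose C z := forall u v, [lie z, [lie u, v]] = 0.
have idC : lie_ideal_pred C.
  split=> [u v|a y z Cy Cz u v|y z Cy u v]; first by rewrite lie0x.
    by rewrite lieDl lieZl Cy Cz scaler0 addr0.
  by rewrite lie_derivl !Cy liex0 subr0.
move=> Cx; apply: lie_center_eq0 => y.
apply: (ideal_center_eq0 idC) => [|z Cz]; first by case: idC => _ _; apply.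
by rewrite lie_anti Cz oppr0.
Qed.

Lemma self_adjoint_centroid T : lie_adjoint_sign 1 T ->
  forall x y, T [lie x, y] = [lie T x, y].
Proof.
move=> T1; have adT x y : [lie T x, y] = [lie x, T y] by rewrite T1 scale1r.
pose phi x y u v := [lie [lie T x, y], [lie u, v]]
                    - [lie [lie x, y], [lie T u, v]].
have antiT x y : [lie T x, y] = - [lie T y, x] by rewrite adT lie_anti.
have phiT x y u v : phi x y u v = phi x v u y.
  have E := biderivation_id x y u v T1.
  rewrite (lie_anti y u) lieNr (lie_anti [lie T u, y]) in E.
  apply: scalar_ext => f; move/(congr1 f): E.
  rewrite /phi !(raddfD, raddfB, raddfN) /= => E.
  by apply: (eq_of_subr E); ring.
have phi12 x y u v : phi y x u v = - phi x y u v.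
  by rewrite /phi antiT (lie_anti y) !lieNl opprB opprK addrC.
(* phi is invariant under one transposition of its arguments and changes sign
   under another, although all transpositions are conjugate. *)
have phi0 x y u v : phi x y u v = 0.
  apply: addvv_eq0 => //; rewrite {1}phi12 phiT phi12 phiT phi12 phiT.
  by rewrite opprK addNr.
have dT x y u v :
    [lie [lie T x, y], [lie u, v]] = [lie [lie x, y], [lie T u, v]].
  by apply/eqP; rewrite -subr_eq0; apply/eqP/phi0.
(* Bracketed with [[lie u, v]], each summand gives up its [T] to [u] by [dT], and the Jacobi
   identity remains. *)
have cyc x y z :
    [lie T x, [lie y, z]] + [lie T y, [lie z, x]] + [lie T z, [lie x, y]] = 0.
  apply: centralizer_derived_eq0 => u v.
  by rewrite !lieDl !dT -!lieDl lie_jacobi lie0x.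
move=> y z; apply/eqP; rewrite -subr_eq0; apply/eqP/lie_center_eq0 => x.
apply/eqP; rewrite lieBl subr_eq0 adT (lie_anti _ x) lie_anti; apply/eqP.
congr (- _).
(* In terms of [P], [cyc] says that minus twice a cyclic sum is zero, and the goal is that this sum
   is zero. *)
pose P x y z := [lie x, [lie y, T z]].
have TP a b c : [lie T a, [lie b, c]] = - P b c a - P c a b.
  by rewrite lie_derivr addrC (lie_anti [lie T a, b]) (lie_anti _ c) lieNr adT.
have := cyc x y z; rewrite !TP => cycP.
rewrite adT -[in RHS]/(P x y z).
have sumP : P x y z + P y z x + P z x y = 0.
  apply: addvv_eq0 => //; apply: scalar_ext => f; move/(congr1 f): cycP.
  rewrite !(raddfD, raddfB, raddfN) /= => E.
  by apply: (eq_of_subr (esym E)); ring.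
by move/eqP: sumP; rewrite -addrA addr_eq0 opprD => /eqP->.
Qed.

Lemma skew_adjoint_sqr0 S : lie_adjoint_sign (-1) S -> forall x, S (S x) = 0.
Proof.
move=> S1; have adS x y : [lie S x, y] = - [lie x, S y] by rewrite S1 scaleN1r.
have symS x y : [lie S x, y] = [lie S y, x] by rewrite adS -lie_anti.
have SS1 : lie_adjoint_sign 1 (S \o S)%VF.
  by move=> x y; rewrite !comp_lfunE !adS opprK scale1r.
have SSl x y : S (S [lie x, y]) = [lie S (S x), y].
  by have := self_adjoint_centroid SS1 x y; rewrite !comp_lfunE.
have SSr x y : [lie S (S x), y] = [lie x, S (S y)].
  by have := SS1 x y; rewrite !comp_lfunE scale1r.
pose p x y u v := [lie S (S [lie x, y]), [lie u, v]].
pose q x y u v := [lie [lie S x, y], [lie S u, v]].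
(* This is the biderivation identity with [S x] in place of [x]. *)
have pq x y u v : p x y u v + p x v y u = q x y u v + q u y x v.
  by rewrite /p /q !SSl (biderivation_id (S x) y u v S1).
have q12 x y u v : q y x u v = q x y u v by rewrite /q symS.
have q34 x y u v : q x y v u = q x y u v by rewrite /q (symS v).
have qC x y u v : q u v x y = - q x y u v by rewrite /q lie_anti.
have p12 x y u v : p y x u v = - p x y u v.
  by rewrite /p (lie_anti y) !linearN lieNl.
have p34 x y u v : p x y v u = - p x y u v.
  by rewrite /p (lie_anti v) lieNr.
have pC x y u v : p u v x y = - p x y u v.
  by rewrite /p lie_anti SSr.
(* Modulo the symmetries of p and q, E1 and E4 give p x y u v = q x y u v,
   while E2 and E3 give p x y u v = - q x y u v. *)
have p0 x y u v : p x y u v = 0.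
  apply: addvv_eq0 => //; apply: addvv_eq0 => //; apply: scalar_ext => f.
  have E1 := pq x y u v; have E2 := pq x y v u.
  have E3 := pq y x u v; have E4 := pq v x y u.
  rewrite (q12 y u) (qC x v) in E1.
  rewrite p34 q34 (q12 y v) (qC x u) in E2.
  rewrite p12 (pC x u) q12 (q12 x u) in E3.
  rewrite (p12 x v) (p12 u v) (pC x y) opprK in E4.
  rewrite (q12 x v) (q12 x y) (q34 x y) in E4.
  have := congr2 +%R (congr2 +%R E1 E4) (esym (congr2 +%R E2 E3)).
  move/(congr1 f); rewrite !(raddfD, raddfB, raddfN, raddf0) /= => E.
  by apply: (eq_of_subr E); ring.
have derSS x y : [lie S (S x), y] = 0.
  apply: centralizer_derived_eq0 => u v; rewrite -SSl.
  exact: p0.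
by move=> x; apply: lie_center_eq0 => y; apply: derSS.
Qed.

(** Polarization: [S], [T] and [S + T] all square to zero. *)
Lemma skew_adjoint_anticomm S T : lie_adjoint_sign (-1) S ->
  lie_adjoint_sign (-1) T -> forall x, S (T x) = - T (S x).
Proof.
move=> S1 T1 x; have ST1 : lie_adjoint_sign (-1) (S + T).
  by move=> u v; rewrite !add_lfunE lieDl lieDr scalerDr S1 T1.
have := skew_adjoint_sqr0 ST1 x; rewrite !add_lfunE !linearD /=.
rewrite (skew_adjoint_sqr0 S1) (skew_adjoint_sqr0 T1) add0r addr0 => /eqP.
by rewrite addr_eq0 => /eqP.
Qed.

(** Moving both factors across the bracket reverses their order and cancels the signs; anticommuting
    them back yields the -1. *)
Lemma skew_adjoint_comp S T : lie_adjoint_sign (-1) S ->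
  lie_adjoint_sign (-1) T -> lie_adjoint_sign (-1) (S \o T)%VF.
Proof.
move=> S1 T1 x y; rewrite !comp_lfunE S1 T1 scalerA mulrNN mulr1 scale1r.
by rewrite (skew_adjoint_anticomm S1 T1) lieNr scaleN1r opprK.
Qed.

(** Holds because [lie_ad h] is a derivation; it makes the common kernel of all skew-adjoint
    operators an ideal. *)
Lemma skew_adjoint_commutator h S : lie_adjoint_sign (-1) S ->
  lie_adjoint_sign (-1) ((lie_ad h \o S) - (S \o lie_ad h))%VF.
Proof.
move=> S1 x y; have adS u v : [lie S u, v] = - [lie u, S v].
  by rewrite S1 scaleN1r.
rewrite !add_lfunE !opp_lfunE !comp_lfunE !lfunE /= lieBl lieBr scaleN1r.
rewrite (lie_derivl h) !adS (lie_derivl h) lieNr !opprK !opprB.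
by rewrite (addrC (- _)) subrKA.
Qed.

Lemma skew_adjoint_eq0 S : lie_adjoint_sign (-1) S -> S = 0.
Proof.
move=> S1; apply/lfunP => x; rewrite zero_lfunE.
(* Strong induction on the rank of [S] replaces the choice of an operator of minimal rank. *)
have [n] := ubnP (\dim (limg S)); elim: n S S1 x => // n IH S S1 x ltSn.
move: x.
have annS T : lie_adjoint_sign (-1) T -> forall x, T (S x) = 0.
  move=> T1; have TS1 := skew_adjoint_comp T1 S1.
  have TSC x : T (S x) = S (- T x).
    by rewrite (skew_adjoint_anticomm T1 S1) linearN.
  have subTS : (limg (T \o S) <= limg S)%VS.
    apply/subvP=> _ /memv_imgP[x _ ->].
    by rewrite comp_lfunE TSC memv_img ?memvf.
  (* If [T \o S] has the rank of [S], the image of [S] lies in that of [T], which [T] kills;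
     otherwise the induction hypothesis applies to [T \o S]. *)
  have [eqTS|ltTS] := eqVneq (\dim (limg (T \o S))) (\dim (limg S)).
    move=> x; have : S x \in limg S by rewrite memv_img ?memvf.
    have /eqP <- : limg (T \o S) == limg S by rewrite eqEdim subTS eqTS leqnn.
    by case/memv_imgP=> w _ ->; rewrite comp_lfunE (skew_adjoint_sqr0 T1).
  move=> x; rewrite -comp_lfunE; apply: (IH _ TS1).
  by rewrite -ltnS; apply: leq_trans ltSn; rewrite ltnS ltn_neqAle ltTS dimvS.
pose K z := forall T, lie_adjoint_sign (-1) T -> T z = 0.
have idK : lie_ideal_pred K.
  split=> [T _|a y z Ky Kz T T1|z h Kz T T1]; first exact: linear0.
    by rewrite linearP /= Ky // Kz // scaler0 addr0.
  have := Kz _ (skew_adjoint_commutator h T1).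
  rewrite !add_lfunE !opp_lfunE !comp_lfunE !lfunE /= Kz // liex0 add0r.
  by rewrite (lie_anti z) linearN.
(* [S x] is in [K] by [annS], and it commutes with [K] because [S] moves across the bracket and
   kills [K]. *)
move=> x; apply: (ideal_center_eq0 idK) => [T T1|z Kz]; first exact: annS.
by rewrite S1 Kz // liex0 scaler0.
Qed.

End NoAbelianIdeal.

(** * The quotient of a Lie algebra by an ideal *)

Section LieQuotient.

Variables (F : fieldType) (L : lieAlgType F) (R : lie_ideal L).

(** Realized on a complement of [R], which provides the vector space structure and the linear
    section [quot_lift]. *)
Definition lie_quot : Type := subvs_of (R^C)%VS.
HB.instance Definition _ := Vector.on lie_quot.

Definition quot_lift (u : lie_quot) : L := vsval (u : subvs_of (R^C)%VS).
HB.instance Definition _ := GRing.Linear.copy quot_lift (@vsval _ _ (R^C)%VS).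

Definition quot_proj (x : L) : lie_quot :=
  vsproj (R^C)%VS (daddv_pi (R^C)%VS R x).

Fact quot_proj_is_linear : linear quot_proj.
Proof. by move=> a x y; rewrite /quot_proj !linearP. Qed.
HB.instance Definition _ :=
  @GRing.isLinear.Build F L lie_quot *:%R quot_proj quot_proj_is_linear.

Let capRC : (R^C :&: R)%VS = 0%VS.
Proof. by rewrite capvC capv_compl. Qed.

Lemma quot_liftK : cancel quot_lift quot_proj.
Proof.
move=> u; rewrite /quot_proj /quot_lift daddv_pi_id ?subvsP //.
exact: vsvalK.
Qed.

Lemma quot_projK x : x - quot_lift (quot_proj x) \in (R : {vspace L}).
Proof.
rewrite /quot_lift vsprojK ?memv_pi //.
have {1}<- := @daddv_pi_add _ _ (R^C)%VS R x capRC.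
  by rewrite addrC addKr memv_pi.
by rewrite addvC addv_complf memvf.
Qed.

Lemma quot_proj_eq0 x : (quot_proj x == 0) = (x \in (R : {vspace L})).
Proof.
apply/eqP/idP => [x0|xR].
  by have := quot_projK x; rewrite x0 linear0 addr0.
have := @daddv_pi_add _ _ (R^C)%VS R x capRC.
rewrite (@daddv_pi_id _ _ R) ?capv_compl // addvC addv_complf memvf.
move=> /(_ isT)/(canRL (addrK _)); rewrite subrr /quot_proj => ->.
exact: linear0.
Qed.

Definition quot_lie (u v : lie_quot) :=
  quot_proj [lie quot_lift u, quot_lift v].

Lemma quot_proj_lie x y :
  quot_proj [lie x, y] = quot_lie (quot_proj x) (quot_proj y).
Proof.
apply/eqP; rewrite -subr_eq0 -linearB /= quot_proj_eq0.
set x' := quot_lift _; set y' := quot_lift _.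
have -> : [lie x, y] - [lie x', y'] = [lie x - x', y] - [lie y - y', x'].
  by rewrite !lieBl (lie_anti y) (lie_anti y') opprB opprK (addrC (- _)) subrKA.
by rewrite rpredB ?lie_idealP ?quot_projK.
Qed.

Fact quot_lie_linear_l v : linear (quot_lie^~ v).
Proof. by move=> a u w; rewrite /quot_lie linearP lieDl lieZl linearP. Qed.

Fact quot_lie_linear_r u : linear (quot_lie u).
Proof. by move=> a v w; rewrite /quot_lie !linearP. Qed.

Fact quot_liexx u : quot_lie u u = 0.
Proof. by rewrite /quot_lie liexx linear0. Qed.

Fact quot_lie_jacobi u v w :
  quot_lie u (quot_lie v w) + quot_lie v (quot_lie w u)
  + quot_lie w (quot_lie u v) = 0.
Proof.
rewrite -[u]quot_liftK -[v]quot_liftK -[w]quot_liftK -!quot_proj_lie.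
by rewrite -!linearD lie_jacobi linear0.
Qed.

HB.instance Definition _ := Vector_isLieAlgebra.Build F lie_quot
  quot_lie_linear_l quot_lie_linear_r quot_liexx quot_lie_jacobi.

Lemma quot_projM x y : quot_proj [lie x, y] = [lie quot_proj x, quot_proj y].
Proof. exact: quot_proj_lie. Qed.

End LieQuotient.

(** * The radical, and operators with image inside it *)

Section Radical.

Variables (F : fieldType) (L : lieAlgType F).
Implicit Types (x y : L) (U V W I : {vspace L}) (S N : 'End(L)).

Lemma lie_derivedS k U V :
  (U <= V)%VS -> (lie_derived k U <= lie_derived k V)%VS.
Proof.
move=> UV; elim: k => //= k /subvP IH; apply: lie_prod_sub => x y /IH xV /IH yV.
exact: mem_lie_prod.
Qed.

Lemma lie_solvable_ext k U V :
  (lie_derived k U <= V)%VS -> lie_solvable V -> lie_solvable U.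
Proof.
move=> UV [m V0]; exists (m + k)%N; apply/eqP; rewrite -subv0 -V0.
by rewrite /lie_derived iterD; apply: lie_derivedS.
Qed.

Lemma is_lie_ideal_add U V :
  is_lie_ideal U -> is_lie_ideal V -> is_lie_ideal (U + V)%VS.
Proof.
move=> idU idV _ y /memv_addP[u uU [v vV ->]].
by rewrite lieDl memv_add ?idU ?idV.
Qed.

(** Modulo the ideal [V], the derived series of [U + V] is that of [U]. *)
Lemma lie_solvable_add U V : is_lie_ideal V ->
  lie_solvable U -> lie_solvable V -> lie_solvable (U + V)%VS.
Proof.
move=> idV [k U0] solV; apply: (lie_solvable_ext (k := k)) solV.
suff : (lie_derived k (U + V) <= lie_derived k U + V)%VS by rewrite U0 add0v.
elim: k {U0} => //= k /subvP IH; apply: lie_prod_sub => x y.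
move=> /IH/memv_addP[a aU [b bV ->]] /IH/memv_addP[c cU [d dV ->]].
rewrite lieDl lieDr -addrA memv_add ?mem_lie_prod //.
by rewrite (lie_anti a) rpredD ?rpredN ?idV.
Qed.

Lemma ex_lie_radical : exists R : {vspace L}, is_lie_radical R.
Proof.
have [||R [idR solR] maxR] := @ex_greatest_vspace _ L
  (fun U => is_lie_ideal U /\ lie_solvable U); last first.
- by exists R; split=> // I idI solI; apply: maxR.
- move=> U V [idU solU] [idV solV].
  by split; [apply: is_lie_ideal_add | apply: lie_solvable_add].
- by split=> [x y|]; [rewrite !memv0 => /eqP->; rewrite lie0x | exists 0%N].
Qed.

(** The preimage of an abelian ideal has its derived algebra in [R], so it is a solvable ideal and
    lies in [R]. *)
Lemma quot_radical_no_abelian_ideal (R : lie_ideal L) :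
  is_lie_radical R -> no_abelian_ideal (lie_quot R).
Proof.
move=> [_ solR maxR] P [P0 Plin Pid] Pab z Pz.
have [||U UP] := @ex_vspace_pred _ _ (fun x => P (quot_proj R x)).
- by rewrite linear0.
- by move=> a x y Px Py; rewrite linearP; apply: Plin.
have idU : is_lie_ideal U.
  by move=> x y /UP Px; apply/UP; rewrite quot_projM; apply: Pid.
have solU : lie_solvable U.
  apply: (lie_solvable_ext (k := 1) _ solR); apply: lie_prod_sub => x y.
  by move=> /UP Px /UP Py; rewrite -quot_proj_eq0 quot_projM Pab.
rewrite -[z]quot_liftK; apply/eqP; rewrite quot_proj_eq0.
by apply: (subvP (maxR _ idU solU)); apply/UP; rewrite quot_liftK.
Qed.

Lemma skew_adjoint_radical (R : lie_ideal L) S : 2 != 0 :> F ->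
  is_lie_radical R -> lie_adjoint_sign (-1) S ->
  forall x, S x \in (R : {vspace L}).
Proof.
move=> two_nz radR S1 x; have noab := quot_radical_no_abelian_ideal radR.
pose Sq : 'End(lie_quot R) := linfun (quot_proj R \o S \o @quot_lift _ _ R).
have Sq1 : lie_adjoint_sign (-1) Sq.
  move=> u v; rewrite !lfunE /= -[v in LHS]quot_liftK -[u in RHS]quot_liftK.
  by rewrite -!quot_projM S1 linearZ.
rewrite -[x](subrK (quot_lift (quot_proj R x))) linearD /= rpredD //.
  (* [S] maps [R] into [R]: for [r] in [R], the class of [S r] is central in the quotient because
     [[lie r, S v]] is in [R]. *)
  rewrite -quot_proj_eq0; apply/eqP/(lie_center_eq0 noab) => v.
  rewrite -[v]quot_liftK -quot_projM S1 scaleN1r linearN /=.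
  apply/eqP; rewrite oppr_eq0 quot_proj_eq0.
  by rewrite lie_idealP ?quot_projK.
rewrite -quot_proj_eq0.
have /lfunP/(_ (quot_proj R x)) := skew_adjoint_eq0 two_nz noab Sq1.
by rewrite lfunE zero_lfunE /= => ->.
Qed.

Lemma unipotent_lie_orthogonal_radical (R : lie_ideal L) N : 2 != 0 :> F ->
  is_lie_radical R -> lie_orthogonal (\1%VF + N) -> lfun_nilpotent N ->
  (limg N <= R)%VS.
Proof.
move=> two_nz radR; set J : 'End(L) := \1%VF + N => oJ [n N0].
have JE x : J x = x + N x by rewrite add_lfunE id_lfunE.
have kerJ : lker J == 0%VS.
  rewrite -subv0; apply/subvP=> x.
  rewrite memv_ker memv0 JE addr_eq0 => /eqP xN.
  (* On the kernel of [J], [N] acts as -1, which is incompatible with nilpotency unless the kernel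
     is zero. *)
  have : iter n N x = (-1) ^+ n *: x.
    elim: n {N0} => [|n IH]; first by rewrite scale1r.
    by rewrite iterS IH linearZ /= {2}xN scalerN exprSr mulrN1 scaleNr opprK.
  by rewrite N0 => /eqP; rewrite eq_sym scaler_eq0 signr_eq0.
have JK := lker0_lfunK kerJ; have JVK := lker0_lfunVK kerJ.
have S1 : lie_adjoint_sign (-1) (J - (J^-1)%VF).
  move=> x y; rewrite !(add_lfunE J) !opp_lfunE lieBl lieBr scaleN1r opprB.
  by congr (_ - _); [rewrite -[RHS]oJ JVK | rewrite -[LHS]oJ JVK].
(* This element is [J (J x) - x], the value of [J - J^-1] at [J x]. *)
have SR x : N x *+ 2 + N (N x) \in (R : {vspace L}).
  have := skew_adjoint_radical two_nz radR S1 (J x).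
  rewrite (add_lfunE J) opp_lfunE JK !JE linearD /=.
  by rewrite mulr2n -!addrA addrC !addrA subrK.
apply/subvP=> _ /memv_imgP[x _ ->].
(* Descent on the exponent: modulo [R], [SR] turns the vanishing of a power of [N] at [x] into that
   of the preceding power, down to [N x]. *)
have : iter n.+1 N x \in (R : {vspace L}) by rewrite iterS N0 linear0 mem0v.
elim: n {N0} => // n IH NR; apply: IH.
have := SR (iter n N x); rewrite -!iterS => /rpredB/(_ NR).
rewrite addrK -scaler_nat => /(memvZ (2%:R^-1)).
by rewrite scalerK.
Qed.

(** [J] may be singular, so [u] is split by Fitting: on the image of [J] orthogonality gives 0, and
    the other part is killed by a power of [J]. *)
Lemma lie_orthogonal_center J z : lie_orthogonal J ->
  z \in lie_center L -> J z \in lie_center L.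
Proof.
move=> oJ /lie_centerP z0; apply/lie_centerP=> u.
have [u0 [m [u00 ->]]] := fitting J u.
have orth k a b : [lie iter k J a, iter k J b] = [lie a, b].
  by elim: k => //= k <-; rewrite oJ.
have [y ->] := iter_lfun_limg J 1 m; rewrite addn1 iterS lieDr oJ z0 addr0.
by rewrite -(orth (\dim {:L})) u00 liex0.
Qed.

End Radical.

(** * The unipotent representative, and the restriction to the ideal *)

Lemma unipotent_part_lie_orthogonal (F : fieldType) (L : lieAlgType F)
    (J : 'End(L)) : lie_orthogonal J ->
  (lie_center L + gen_eigenspace J 1)%VS = fullv ->
  exists N : 'End(L),
    [/\ lie_orthogonal (\1%VF + N), lie_equiv J (\1%VF + N)
      & lfun_nilpotent N].
Proof.
move=> oJ ZU; set Z := lie_center L in ZU *.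
set U := gen_eigenspace J 1 in ZU *.
(* The center comes first in the sum because [addv_pi2] is the identity on its second argument, here
   [U]. *)
pose h : 'End(L) := J - 1 *: \1%VF; pose p := addv_pi2 Z U.
have hE x : h x = J x - x.
  by rewrite add_lfunE opp_lfunE scale_lfunE id_lfunE scale1r.
have pU x : p x \in U by apply: memv_pi2.
have pE x : exists2 z, z \in Z & x = p x + z.
  exists (addv_pi1 Z U x); first exact: memv_pi1.
  by rewrite addrC addv_pi1_pi2 // ZU memvf.
have hU x : x \in U -> h x \in U.
  move=> /gen_eigenspaceP[k x0]; apply/gen_eigenspaceP; exists k.
  by rewrite -iterSr /= x0 linear0.
exists (h \o p)%VF.
have NE x z : x = p x + z -> (\1%VF + (h \o p)%VF) x = J (p x) + z.
  move=> xE; rewrite add_lfunE id_lfunE comp_lfunE hE {1}xE.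
  by rewrite addrC addrA addrNK.
split=> [x y||].
- have [z zZ xE] := pE x; have [w wZ yE] := pE y.
  rewrite (NE _ _ xE) (NE _ _ yE) [in RHS]xE [in RHS]yE !lieDl !lieDr oJ.
  by rewrite !(lie_anti _ w) !(lie_centerP _ zZ) !(lie_centerP _ wZ).
- apply/subvP=> _ /memv_imgP[x _ ->]; have [z zZ xE] := pE x.
  have Jx : J x = J (p x) + J z by rewrite -linearD -xE.
  rewrite add_lfunE opp_lfunE (NE _ _ xE) Jx opprD addrACA subrr add0r.
  by rewrite rpredB // lie_orthogonal_center.
(* One application enters [U]; the remaining [\dim {:L}] annihilate it. *)
- exists (\dim {:L}).+1 => x; rewrite iterSr.
  have NU k y : y \in U -> iter k (h \o p)%VF y = iter k h y.
    elim: k y => // k IH y yU; rewrite !iterSr comp_lfunE /p addv_pi2_id //.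
    by rewrite IH ?hU.
  have yU : (h \o p)%VF x \in U by rewrite comp_lfunE hU.
  by rewrite NU //; apply/eqP; rewrite -lfun_powE -memv_ker.
Qed.

Theorem proposition9 (F : closedFieldType) (charF0 : [pchar F] =i pred0)
    (L : lieAlgType F) (J : 'End(L)) (oJ : lie_orthogonal J)
    (eig1 : passmx.leigenvalue J 1) :
  let I1 := ideal_I1 oJ in
  let J1 : 'End(subvs_of I1) := lfun_restrict I1 J in
  exists2 R1 : {vspace subvs_of I1}, is_lie_radical R1
    & exists N : 'End(subvs_of I1),
        [/\ lie_orthogonal (\1%VF + N),
            lie_equiv J1 (\1%VF + N),
            lfun_nilpotent N
          & (limg N <= R1)%VS].
Proof.
move=> I1 J1.
have two_nz : 2 != 0 :> F by have /pcharf0P-> := charF0.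
have J1E u : vsval (J1 u) = J (vsval u).
  by apply: vsval_lfun_restrict; apply: J_invariant_I1.
have ZU : (lie_center (subvs_of I1) + gen_eigenspace J1 1)%VS = fullv.
  apply/vspaceP=> u; rewrite memvf.
  have /memv_addP[x xL1 [z zZ uE]] := subvsP u.
  have xI1 : x \in (I1 : {vspace L}).
    by rewrite -[x]addr0 memv_add ?mem0v.
  have zI1 : z \in (I1 : {vspace L}).
    by rewrite -[z]add0r memv_add ?mem0v.
  have -> : u = vsproj I1 z + vsproj I1 x.
    by apply: (@subvs_inj _ _ I1); rewrite linearD /= !vsprojK // uE addrC.
  apply: memv_add.
    apply/lie_centerP=> v; apply: subvs_inj.
    apply: etrans (vsval_lie _ _) _; rewrite vsprojK //.
    by rewrite (lie_centerP _ zZ) linear0.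
  (* The two generalized eigenspaces are defined with different exponents, the dimensions of the
     ideal and of [L]; an existential exponent transfers. *)
  apply/gen_eigenspaceP; case/gen_eigenspaceP: xL1 => k xk; exists k.
  apply: val_inj; rewrite linear0 -xk /= -[in RHS](vsprojK xI1).
  elim: k {xk} => //= k; rewrite !(add_lfunE, opp_lfunE, scale_lfunE, id_lfunE).
  by rewrite linearB linearZ /= J1E => ->.
have [N [oN eqN nilN]] :=
  unipotent_part_lie_orthogonal (@lie_orthogonal_I1 _ _ _ oJ) ZU.
have [R1 radR1] := ex_lie_radical (subvs_of I1); exists R1 => //; exists N.
have [idR1 _ _] := radR1.
by split=> //; apply: (@unipotent_lie_orthogonal_radical _ _ (LieIdeal idR1)).
Qed.
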